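(* For every state $\rho$ on $\mathcal{H}_{AB}=\mathbb{C}^{d_A}\otimes\mathbb{C}^{d_B}$, $$\inf_{\sigma\in\mathcal{SEP}(\mathcal{H}_{AB})}\|\rho-\sigma\|_{\mathrm{Tr}}\le2\,\mathcal{E}(\rho),$$ where $\|X\|_{\mathrm{Tr}}=\operatorname{Tr}\sqrt{X^\dagger X}$ is the trace norm.
   Context: Let $\mathcal{H}_A=\mathbb{C}^{d_A}$, $\mathcal{H}_B=\mathbb{C}^{d_B}$, $\mathcal{H}_{AB}=\mathcal{H}_A\otimes\mathcal{H}_B$. Write $\mathcal{D}(\mathcal{H})$ for the density operators on $\mathcal{H}$, $\|\cdot\|_{op}$ for the operator norm, and $\mathcal{SEP}(\mathcal{H}_{AB})$ for the set of separable states (convex combinations of product states $\sigma_A\otimes\sigma_B$). Fix a family $\{F_i^A\}_{i=1}^{d_A^2-1}$ of traceless Hermitian $d_A\times d_A$ matrices with $\operatorname{Tr}(F_i^AF_j^A)=\delta_{ij}$ and $\|F_i^A\|_{op}\le1$, and similarly a family $\{F_j^B\}_{j=1}^{d_B^2-1}$ for $B$. Let $\mathcal{K}_0=\{F_i^A\otimes I_B\}_i\cup\{I_A\otimes F_j^B\}_j$. On two copies $\mathcal{H}_{AB}^{(1)}\otimes\mathcal{H}_{AB}^{(2)}$ of $\mathcal{H}_{AB}$ define the cost operator $$C=\sum_{X\in\mathcal{K}_0}\bigl(X\otimes I_{AB}^{(2)}-I_{AB}^{(1)}\otimes X\bigr)^2 .$$ For $\rho,\sigma\in\mathcal{D}(\mathcal{H}_{AB})$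 let $\Pi(\rho,\sigma)$ be the set of density operators on $\mathcal{H}_{AB}^{(1)}\otimes\mathcal{H}_{AB}^{(2)}$ with marginals $\rho$ and $\sigma$. The quantum Wasserstein distance of order 1 is $W_1(\rho,\sigma)=\bigl(\inf_{\tau\in\Pi(\rho,\sigma)}\operatorname{Tr}[C\tau]\bigr)^{1/2}$, and the Wasserstein entanglement measure is $$\mathcal{E}(\rho)=\inf_{\sigma\in\mathcal{SEP}(\mathcal{H}_{AB})}W_1(\rho,\sigma).$$ *)

(* Defs.v *)
From HB Require Import structures.
From mathcomp Require Export all_boot all_order all_algebra.
From mathcomp Require Export classical_sets reals.
From mathcomp Require Export complex mxtens.

Set Implicit Arguments.
Unset Strict Implicit.
Unset Printing Implicit Defensive.

Import Order.TTheory GRing.Theory Num.Theory.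

Local Open Scope classical_set_scope.
Local Open Scope ring_scope.
Local Open Scope complex_scope.
Local Open Scope sesquilinear_scope.

Section QuantumWasserstein.
Variable R : realType.
Local Notation C := R[i].

Definition psdmx n (A : 'M[C]_n) : Prop :=
  A \is hermsymmx /\ forall v : 'cV[C]_n, 0 <= (v ^t* *m A *m v) 0 0.

Definition density n : set 'M[C]_n := [set A | psdmx A /\ \tr A = 1].
Arguments density : clear implicits.

Definition vecnorm n (v : 'cV[C]_n) : R :=
  Num.sqrt (complex.Re ((v ^t* *m v) 0 0)).

(* The supremum is over the closed unit ball, so that it is also the right one
   in dimension 0, where there is no unit vector. *)
Definition opnorm n (A : 'M[C]_n) : R :=
  sup [set vecnorm (A *m v) | v in [set v : 'cV[C]_n | vecnorm v <= 1]].

(* The square root of a positive semidefinite matrix by functional calculus: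
   A = P^-1 diag(d) P with P unitary is the library's spectral decomposition.
   The value is meaningless when A is not normal. *)
Definition sqrtmx n (A : 'M[C]_n) : 'M[C]_n :=
  invmx (spectralmx A) *m diag_mx (map_mx sqrtC (spectral_diag A))
    *m spectralmx A.

(* \tr (sqrtmx _) is a nonnegative real here; Re only changes its type. *)
Definition trnorm n (X : 'M[C]_n) : R :=
  complex.Re (\tr (sqrtmx (X ^t* *m X))).

(* C^m (x) C^n is C^(m * n), with basis e_i (x) e_j at mxtens_index (i, j);
   ptrace1 traces out the first factor and ptrace2 the second. *)
Definition ptrace1 m n (T : 'M[C]_(m * n)) : 'M[C]_n :=
  \matrix_(i, j) \sum_(k < m) T (mxtens_index (k, i)) (mxtens_index (k, j)).

Definition ptrace2 m n (T : 'M[C]_(m * n)) : 'M[C]_m :=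
  \matrix_(i, j) \sum_(k < n) T (mxtens_index (i, k)) (mxtens_index (j, k)).

Definition coupling n (rho sigma : 'M[C]_n) : set 'M[C]_(n * n) :=
  [set tau | [/\ density _ tau, ptrace2 tau = rho & ptrace1 tau = sigma]].

Definition separable dA dB : set 'M[C]_(dA * dB) :=
  [set sigma | exists (k : nat) (p : 'I_k -> R)
      (sA : 'I_k -> 'M[C]_dA) (sB : 'I_k -> 'M[C]_dB),
    [/\ forall i, 0 <= p i, \sum_i p i = 1,
        forall i, density _ (sA i), forall i, density _ (sB i)
      & sigma = \sum_i (p i)%:C *: (sA i *t sB i)]].

Arguments separable : clear implicits.

Definition cost_family d (F : 'I_(d ^ 2 - 1) -> 'M[C]_d) : Prop :=
  [/\ forall i, F i \is hermsymmx, forall i, \tr (F i) = 0,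
      forall i j, \tr (F i *m F j) = (i == j)%:R
    & forall i, opnorm (F i) <= 1].

Section Cost.
Variables (dA dB : nat).
Variables (FA : 'I_(dA ^ 2 - 1) -> 'M[C]_dA) (FB : 'I_(dB ^ 2 - 1) -> 'M[C]_dB).

(* For families satisfying cost_family the listed matrices are pairwise
   distinct, so a sum over this list is a sum over the set of its elements. *)
Definition K0 : seq 'M[C]_(dA * dB) :=
  [seq FA i *t 1%:M | i : 'I_(dA ^ 2 - 1)]
    ++ [seq 1%:M *t FB j | j : 'I_(dB ^ 2 - 1)].

Definition cost : 'M[C]_(dA * dB * (dA * dB)) :=
  \sum_(X <- K0) (X *t 1%:M - 1%:M *t X) ^+ 2.

(* \tr (cost *m tau) is real since cost and tau are Hermitian. *)
Definition W1 (rho sigma : 'M[C]_(dA * dB)) : R :=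
  Num.sqrt (inf [set complex.Re (\tr (cost *m tau)) | tau in coupling rho sigma]).

Definition went (rho : 'M[C]_(dA * dB)) : R :=
  inf [set W1 rho sigma | sigma in separable dA dB].

End Cost.

End QuantumWasserstein.

Arguments density {R} n.
Arguments separable {R} dA dB.

(* Main.v *)
(* Completeness of the families F^A, F^B turns the cost into
   C = 2 (dA - S_A) + 2 (dB - S_B), where S_A and S_B swap the A and the B
   factors of the two copies, and hence C >= 2 (1 - S) for the full swap
   S = S_A S_B. If U is the sign of rho - sigma and D = U (x) 1 - 1 (x) U, the
   trace norm of rho - sigma is Tr[D tau] for every coupling tau; D anticommutes
   with S and D^2 <= 4, so Cauchy-Schwarz gives
   ||rho - sigma||^2 <= 8 Tr[(1 - S) tau] <= 4 Tr[C tau]. *)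
Require Import Defs.
From mathcomp Require Import ring lra.

Set Implicit Arguments.
Unset Strict Implicit.
Unset Printing Implicit Defensive.

Import Order.TTheory GRing.Theory Num.Theory.

Local Open Scope classical_set_scope.
Local Open Scope ring_scope.
Local Open Scope complex_scope.
Local Open Scope sesquilinear_scope.

(** * Indices of tensor products *)

Lemma big_mxtens (V : nmodType) m n (F : 'I_(m * n) -> V) :
  \sum_k F k = \sum_i \sum_j F (mxtens_index (i, j)).
Proof.
rewrite pair_bigA (reindex (@mxtens_index m n)) /=; last first.
  by exists (@mxtens_unindex m n) => k _; rewrite ?mxtens_indexK ?mxtens_unindexK.
by apply: eq_bigr => -[].
Qed.

Lemma eq_mxtens_index m n (i i' : 'I_m) (j j' : 'I_n) :
  (mxtens_index (i, j) == mxtens_index (i', j')) = (i == i') && (j == j').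
Proof. by rewrite (can_eq (@mxtens_indexK m n)) xpair_eqE. Qed.

(** Serves matrices whose two sizes, such as [d ^ 2 - 1 + 1] and [d * d], are equal but not
    convertible. *)
Lemma mulmx1C_cast (F : fieldType) m n (A : 'M[F]_(m, n)) (B : 'M_(n, m)) :
  m = n -> A *m B = 1%:M -> B *m A = 1%:M.
Proof. by move=> e; case: n / e in A B *; exact: mulmx1C. Qed.

(** * Permutation matrices of involutions *)

Section InvolutionMatrix.
Variables (C : numClosedFieldType) (n : nat).

(** A permutation matrix given by a function on indices, so that products reduce to evaluating [f];
    for an involution it is Hermitian and unitary. *)
Definition fun_mx (f : 'I_n -> 'I_n) : 'M[C]_n := \matrix_(i, j) (f i == j)%:R.

Lemma mul_fun_mx f p (A : 'M_(n, p)) :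
  fun_mx f *m A = \matrix_(i, j) A (f i) j.
Proof.
apply/matrixP => i j; rewrite !mxE (bigD1 (f i)) //= mxE eqxx mul1r.
by rewrite big1 ?addr0 // => k; rewrite mxE eq_sym => /negPf ->; rewrite mul0r.
Qed.

Variable f : 'I_n -> 'I_n.
Hypothesis fK : involutive f.

Lemma mulmx_fun p (A : 'M_(p, n)) : A *m fun_mx f = \matrix_(i, j) A i (f j).
Proof.
apply/matrixP => i j; rewrite !mxE (bigD1 (f j)) //= mxE fK eqxx mulr1.
rewrite big1 ?addr0 // => k; rewrite mxE => ne.
by case: eqP => e; rewrite ?mulr0 //; move: ne; rewrite -e fK eqxx.
Qed.

Lemma fun_mx_sqr : fun_mx f *m fun_mx f = 1%:M.
Proof. by rewrite mul_fun_mx; apply/matrixP => i j; rewrite !mxE fK. Qed.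

Lemma fun_mx_adj : (fun_mx f)^t* = fun_mx f.
Proof.
apply/matrixP => i j; rewrite !mxE conjC_nat; congr _%:R.
by rewrite -(inj_eq (can_inj fK)) fK eq_sym.
Qed.

End InvolutionMatrix.

(** * The partial swaps of two copies of a bipartite system *)

Section Swaps.
Variables (C : numClosedFieldType) (dA dB : nat).

Definition swapA (k : 'I_(dA * dB * (dA * dB))) :=
  let x := mxtens_unindex (mxtens_unindex k).1 in
  let y := mxtens_unindex (mxtens_unindex k).2 in
  mxtens_index (mxtens_index (y.1, x.2), mxtens_index (x.1, y.2)).

Definition swapB (k : 'I_(dA * dB * (dA * dB))) :=
  let x := mxtens_unindex (mxtens_unindex k).1 in
  let y := mxtens_unindex (mxtens_unindex k).2 in
  mxtens_index (mxtens_index (x.1, y.2), mxtens_index (y.1, x.2)).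

Lemma swapAE a b c e : swapA (mxtens_index (mxtens_index (a, b), mxtens_index (c, e)))
  = mxtens_index (mxtens_index (c, b), mxtens_index (a, e)).
Proof. by rewrite /swapA !mxtens_indexK. Qed.

Lemma swapBE a b c e : swapB (mxtens_index (mxtens_index (a, b), mxtens_index (c, e)))
  = mxtens_index (mxtens_index (a, e), mxtens_index (c, b)).
Proof. by rewrite /swapB !mxtens_indexK. Qed.

Lemma swapAK : involutive swapA.
Proof.
move=> k; case: (mxtens_indexP k) => x y.
by case: (mxtens_indexP x) => a b; case: (mxtens_indexP y) => c e; rewrite !swapAE.
Qed.

Lemma swapBK : involutive swapB.
Proof.
move=> k; case: (mxtens_indexP k) => x y.
by case: (mxtens_indexP x) => a b; case: (mxtens_indexP y) => c e; rewrite !swapBE.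
Qed.

Lemma swapABC k : swapA (swapB k) = swapB (swapA k).
Proof.
case: (mxtens_indexP k) => x y.
by case: (mxtens_indexP x) => a b; case: (mxtens_indexP y) => c e;
  rewrite !(swapAE, swapBE).
Qed.

Lemma swapAB x y : swapA (swapB (mxtens_index (x, y))) = mxtens_index (y, x).
Proof.
by case: (mxtens_indexP x) => a b; case: (mxtens_indexP y) => c e;
  rewrite swapBE swapAE.
Qed.

Lemma swapAB_mx_comm :
  fun_mx C swapA *m fun_mx C swapB = fun_mx C swapB *m fun_mx C swapA.
Proof.
by rewrite !mul_fun_mx; apply/matrixP => i j; rewrite !mxE swapABC.
Qed.

(** The product of the two partial swaps exchanges the whole copies, by [swapAB], hence exchanges
    the two tensor factors. *)
Lemma swap_tensmx (U V : 'M[C]_(dA * dB)) :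
  fun_mx C swapA *m fun_mx C swapB *m (U *t V)
  = (V *t U) *m (fun_mx C swapA *m fun_mx C swapB).
Proof.
rewrite -mulmxA [RHS]mulmxA (mulmx_fun (@swapBK)) (mulmx_fun (@swapAK)).
rewrite !mul_fun_mx.
apply/matrixP => i j; rewrite !mxE -swapABC.
case: (mxtens_indexP i) => x y; case: (mxtens_indexP j) => x' y'.
by rewrite !swapAB !mxtens_indexK /= mulrC.
Qed.

End Swaps.

(** * Completeness of an orthonormal traceless family *)

Section CostFamily.
Variables (R : realType) (d : nat) (F : 'I_(d ^ 2 - 1) -> 'M[R[i]]_d).
Hypothesis hF : cost_family F.

(* [F] together with the identity is a basis of the d x d matrices, whose dual
   basis for the form [tr (A *m B)] is [F] together with [d^-1 *: 1]. *)
Lemma cost_family_completeness a b c e :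
  \sum_i F i a b * F i c e =
  ((a == e) && (b == c))%:R - ((a == b) && (c == e))%:R / d%:R.
Proof.
case: hF => _ trF orthF _.
have d_gt0 : (0 < d)%N by case: (d) a => [[]|].
have dN0 : d%:R != 0 :> R[i] by rewrite pnatr_eq0 -lt0n.
pose vec (G : 'M[R[i]]_d) : 'rV_(d * d) :=
  \row_k G (mxtens_unindex k).1 (mxtens_unindex k).2.
have vecM G H : (vec G *m (vec H^T)^T) 0 0 = \tr (G *m H).
  rewrite mxE big_mxtens; apply: eq_bigr => i _; rewrite mxE.
  by apply: eq_bigr => j _; rewrite !mxE mxtens_indexK.
pose M := col_mx (\matrix_i vec (F i)) (vec 1%:M).
pose N := row_mx (\matrix_i vec (F i)^T)^T (d%:R^-1 *: (vec 1%:M)^T).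
(* The four blocks are orthonormality, tracelessness (twice) and the normalisation [\tr 1 = d]. *)
have MN : M *m N = 1%:M.
  rewrite mul_col_row scalar_mx_block; congr block_mx.
  - apply/matrixP => i j; rewrite !mxE -[RHS]orthF -vecM mxE.
    by apply: eq_bigr => k _; rewrite !mxE.
  - apply/matrixP => i j; rewrite -scalemxAr ord1 [RHS]mxE -(mulr0 d%:R^-1).
    rewrite -[X in _ = _ * X](trF i) -[F i]mulmx1 -vecM trmx1 !mxE.
    by congr (_ * _); apply: eq_bigr => k _; rewrite !mxE.
  - apply/matrixP => i j; rewrite ord1 [RHS]mxE.
    rewrite -(trF j) -[F j]mul1mx -vecM !mxE.
    by apply: eq_bigr => k _; rewrite !mxE.
  - rewrite -scalemxAr [vec _ *m _]mx11_scalar -[X in vec _ *m (vec X)^T]trmx1 vecM.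
    by rewrite mulmx1 mxtrace1 -scalemx1 scalerA mulVf // scale1r.
(* Completeness is the inverse relation in the other order; the sizes agree because
   [d ^ 2 - 1 + 1 = d * d] for positive [d]. *)
have NM : N *m M = 1%:M.
  by apply: mulmx1C_cast MN; rewrite addn1 subn1 prednK ?expn_gt0 ?d_gt0 // expnS expn1.
(* The row index is [(b, a)] and not [(a, b)] because [N] is built from the transposes of the
   [F i]. *)
move/matrixP/(_ (mxtens_index (b, a)) (mxtens_index (c, e))): NM.
rewrite mul_row_col !mxE big_ord1 eq_mxtens_index !mxE !mxtens_indexK /=.
rewrite (eq_sym b a) => E; rewrite andbC -E -mulnb natrM [X in _ - X]mulrC mulrA addrK.
by apply: eq_bigr => i _; rewrite !mxE !mxtens_indexK.
Qed.

(** The completeness relation contracted over its two inner indices. *)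
Lemma cost_family_sum_sqr : \sum_i F i *m F i = (d%:R - d%:R^-1)%:M.
Proof.
apply/matrixP => a e; rewrite summxE.
under eq_bigr => i _ do rewrite mxE.
rewrite exchange_big /=.
under eq_bigr => b _ do rewrite cost_family_completeness eqxx andbT.
rewrite big_split /= sumr_const card_ord sumrN -mulr_suml (bigD1 a) //= eqxx.
rewrite big1 ?addr0 => [|b]; last by rewrite eq_sym => /negPf ->.
by rewrite mxE; case: eqP => _; rewrite ?mulr1n ?mul1r // mulr0n mul0rn mul0r subr0.
Qed.

End CostFamily.

(** * Sums and squares of tensor products *)

Section Tensor.
Variable K : comPzRingType.

Lemma tensmx_suml (I : finType) m n p q (A : I -> 'M[K]_(m, n)) (B : 'M_(p, q)) :
  (\sum_i A i) *t B = \sum_i A i *t B.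
Proof.
apply/matrixP => i j; rewrite !mxE !summxE mulr_suml.
by apply: eq_bigr => k _; rewrite mxE.
Qed.

Lemma tensmx_sumr (I : finType) m n p q (A : 'M_(m, n)) (B : I -> 'M[K]_(p, q)) :
  A *t (\sum_i B i) = \sum_i A *t B i.
Proof.
apply/matrixP => i j; rewrite !mxE !summxE mulr_sumr.
by apply: eq_bigr => k _; rewrite mxE.
Qed.

Lemma tens_scalar_scalar_mx m n (a b : K) :
  (a%:M : 'M_m) *t (b%:M : 'M_n) = (a * b)%:M.
Proof.
apply/matrixP => i j; case: (mxtens_indexP i) => x y; case: (mxtens_indexP j) => z t.
rewrite tensmxE !mxE eq_mxtens_index.
by do 2!case: eqP => _; rewrite ?mulr1n ?mulr0n ?mulr0 ?mul0r.
Qed.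

(** [X *t 1] and [1 *t X] commute, so both cross terms are [X *t X]. *)
Lemma tensmx_comm_sqr n (X : 'M[K]_n) :
  (X *t 1%:M - 1%:M *t X) ^+ 2
  = (X *m X) *t 1%:M + 1%:M *t (X *m X) - (X *t X) *+ 2.
Proof.
rewrite expr2 -[_ * _]/(_ *m _) mulmxBl !mulmxBr !tensmx_mul !mulmx1 !mul1mx.
by rewrite opprB addrACA -opprD -mulr2n.
Qed.

Lemma sum_tensmx_comm_sqr (I : finType) n (X : I -> 'M[K]_n) :
  \sum_i (X i *t 1%:M - 1%:M *t X i) ^+ 2
  = (\sum_i X i *m X i) *t 1%:M + 1%:M *t (\sum_i X i *m X i)
    - (\sum_i X i *t X i) *+ 2.
Proof.
under eq_bigr => i _ do rewrite tensmx_comm_sqr.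
by rewrite sumrB big_split /= tensmx_suml tensmx_sumr -sumrMnl.
Qed.

End Tensor.

(** * The cost operator in terms of the partial swaps *)

Section Cost.
Variables (R : realType) (dA dB : nat).
Variables (FA : 'I_(dA ^ 2 - 1) -> 'M[R[i]]_dA) (FB : 'I_(dB ^ 2 - 1) -> 'M[R[i]]_dB).
Hypotheses (hFA : cost_family FA) (hFB : cost_family FB).
Local Notation SA := (fun_mx R[i] (@swapA dA dB)).
Local Notation SB := (fun_mx R[i] (@swapB dA dB)).

(** In the completeness relation the first Kronecker term is the swap of the A factors and the
    second is the identity. *)
Lemma sum_tensA :
  \sum_i (FA i *t 1%:M) *t (FA i *t 1%:M) = SA - (dA%:R^-1)%:M.
Proof.
apply/matrixP => k l; rewrite summxE.
case: (mxtens_indexP k) => x y; case: (mxtens_indexP l) => x' y'.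
case: (mxtens_indexP x) => a b; case: (mxtens_indexP y) => c e.
case: (mxtens_indexP x') => a' b'; case: (mxtens_indexP y') => c' e'.
rewrite !mxE swapAE !eq_mxtens_index.
under eq_bigr => i _ do rewrite !tensmxE mulrACA !mxE.
rewrite -mulr_suml (cost_family_completeness hFA) (eq_sym c a').
(* Both sides depend only on six equalities between indices; all truth values are tried. *)
do 6?[case: (_ == _) => /=];
 rewrite ?mulr1 ?mulr0 ?mul1r ?mul0r ?mulr1n ?mulr0n ?subr0 ?sub0r ?subrr //.
Qed.

Lemma sum_tensB :
  \sum_i (1%:M *t FB i) *t (1%:M *t FB i) = SB - (dB%:R^-1)%:M.
Proof.
apply/matrixP => k l; rewrite summxE.
case: (mxtens_indexP k) => x y; case: (mxtens_indexP l) => x' y'.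
case: (mxtens_indexP x) => a b; case: (mxtens_indexP y) => c e.
case: (mxtens_indexP x') => a' b'; case: (mxtens_indexP y') => c' e'.
rewrite !mxE swapBE !eq_mxtens_index.
under eq_bigr => i _ do rewrite !tensmxE mulrACA !mxE.
rewrite -mulr_sumr (cost_family_completeness hFB) (eq_sym e b').
do 6?[case: (_ == _) => /=];
 rewrite ?mulr1 ?mulr0 ?mul1r ?mul0r ?mulr1n ?mulr0n ?subr0 ?sub0r ?subrr //.
Qed.

(** The terms in [dA^-1] and [dB^-1] from the squares cancel those from the cross terms. *)
Lemma costE : cost FA FB = ((dA + dB)%:R%:M - (SA + SB)) *+ 2.
Proof.
rewrite /cost /K0 big_cat !big_image /=.
have sqrA : \sum_i (FA i *t 1%:M) *m (FA i *t 1%:M)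
    = (dA%:R - dA%:R^-1)%:M :> 'M_(dA * dB).
  under eq_bigr => i _ do rewrite tensmx_mul mulmx1.
  by rewrite -tensmx_suml cost_family_sum_sqr // tens_scalar_scalar_mx mulr1.
have sqrB : \sum_i (1%:M *t FB i) *m (1%:M *t FB i)
    = (dB%:R - dB%:R^-1)%:M :> 'M_(dA * dB).
  under eq_bigr => i _ do rewrite tensmx_mul mulmx1.
  by rewrite -tensmx_sumr cost_family_sum_sqr // tens_scalar_scalar_mx mul1r.
rewrite !sum_tensmx_comm_sqr sum_tensA sum_tensB sqrA sqrB.
rewrite !tens_scalar_scalar_mx !mulr1 !mul1r.
rewrite -!(mulr2n _%:M) -!mulrnBl -mulrnDl; congr (_ *+ _).
rewrite natrD !raddfB raddfD /= !opprK !(addrC (- fun_mx _ _) _%:M).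
by rewrite !subrKA opprD addrACA.
Qed.

End Cost.

(** * Adjoints, spectral decomposition and uniqueness of square roots *)

Section Adjoint.
Variable C : numClosedFieldType.

Lemma hermsymmxP n (A : 'M[C]_n) : reflect (A^t* = A) (A \is hermsymmx).
Proof.
by apply: (iffP (is_hermitianmxP _ _ _)); rewrite /= expr0 scale1r => /esym.
Qed.

Lemma adjmxM m n p (A : 'M[C]_(m, n)) (B : 'M_(n, p)) : (A *m B)^t* = B^t* *m A^t*.
Proof. by rewrite trmx_mul map_mxM. Qed.

Lemma adjmxD m n (A B : 'M[C]_(m, n)) : (A + B)^t* = A^t* + B^t*.
Proof. by rewrite raddfD map_mxD. Qed.

Lemma adjmxB m n (A B : 'M[C]_(m, n)) : (A - B)^t* = A^t* - B^t*.
Proof. by rewrite raddfB map_mxB. Qed.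

Lemma adjmxZ m n (a : C) (A : 'M[C]_(m, n)) : (a *: A)^t* = Num.conj a *: A^t*.
Proof. by rewrite linearZ map_mxZ. Qed.

Lemma adjmx1 n : (1%:M : 'M[C]_n)^t* = 1%:M.
Proof. by rewrite trmx1 map_mx1. Qed.

Lemma adjmx_tens m n p q (A : 'M[C]_(m, n)) (B : 'M_(p, q)) :
  (A *t B)^t* = A^t* *t B^t*.
Proof. by rewrite trmx_tens map_mxT. Qed.

Lemma adj_diag_mx n (d : 'rV[C]_n) : (diag_mx d)^t* = diag_mx (map_mx Num.conj d).
Proof. by rewrite tr_diag_mx map_diag_mx. Qed.

Lemma hermsymmx_spectral n (A : 'M[C]_n) : A \is hermsymmx ->
  exists2 P : 'M[C]_n, P \is unitarymx &
  exists2 x : 'rV[C]_n, map_mx Num.conj x = x & A = P^t* *m diag_mx x *m P.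
Proof.
move=> hA; exists (spectralmx A); first exact: spectral_unitarymx.
exists (spectral_diag A).
  by apply: realmxC; exact: hermitian_spectral_diag_real.
rewrite -invmx_unitary ?spectral_unitarymx //.
exact/orthomx_spectralP/hermitian_normalmx.
Qed.

(* The entries of P Q^* vanish wherever the squares differ. *)
Lemma unitary_diag_sqrt n (P Q : 'M[C]_n) (x y : 'rV[C]_n) :
  P \is unitarymx -> Q \is unitarymx ->
  (forall i, 0 <= x 0 i) -> (forall i, 0 <= y 0 i) ->
  P^t* *m diag_mx (map_mx (fun z => z ^+ 2) x) *m P
    = Q^t* *m diag_mx (map_mx (fun z => z ^+ 2) y) *m Q ->
  P^t* *m diag_mx x *m P = Q^t* *m diag_mx y *m Q.
Proof.
move=> uP uQ x0 y0 E.
have PP : P *m P^t* = 1%:M by exact/unitarymxP.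
have QQ : Q *m Q^t* = 1%:M by exact/unitarymxP.
(* With [w = P *m Q^t*], the hypothesis says that [x_i ^ 2 * w_ij = w_ij * y_j ^ 2]; nonnegativity
   then allows the squares to be dropped wherever [w_ij] is nonzero. *)
suff W : diag_mx x *m (P *m Q^t*) = (P *m Q^t*) *m diag_mx y.
  rewrite -[RHS]mul1mx -(mulmx1C PP) -[LHS]mulmx1 -(mulmx1C QQ).
  by move: W; rewrite !mulmxA => /(congr1 (fun Z => P^t* *m Z *m Q)); rewrite !mulmxA.
move: E => /(congr1 (fun Z => P *m Z *m Q^t*)).
rewrite !mulmxA PP mul1mx -!mulmxA QQ mulmx1 !mulmxA => W.
apply/matrixP => i j; move/matrixP/(_ i j): W.
rewrite -!mulmxA mul_diag_mx [in X in X -> _]mulmxA mul_mx_diag.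
rewrite mul_diag_mx mulmxA mul_mx_diag !mxE => /eqP.
rewrite mulrC -subr_eq0 -mulrBr mulf_eq0 subr_eq0 => /orP[/eqP ->|].
  by rewrite mulr0 mul0r.
by rewrite eqrXn2 // => /eqP ->; rewrite mulrC.
Qed.

End Adjoint.

(** * Calculus of matrices diagonal in a fixed orthonormal basis *)

Section UnitaryConjugation.
Variable C : numClosedFieldType.

Lemma mulmx_adj_ge0 m n (A : 'M[C]_(m, n)) i : 0 <= (A *m A^t*) i i.
Proof. by rewrite mxE sumr_ge0 // => j _; rewrite !mxE mul_conjC_ge0. Qed.

Lemma hermsymmx_adj_mul m n (A : 'M[C]_(m, n)) : A^t* *m A \is hermsymmx.
Proof. by apply/hermsymmxP; rewrite adjmxM trmxCK. Qed.

Lemma mul_diag_conj n (P : 'M[C]_n) (x y : 'rV[C]_n) : P \is unitarymx ->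
  (P^t* *m diag_mx x *m P) *m (P^t* *m diag_mx y *m P)
  = P^t* *m diag_mx (\row_i (x 0 i * y 0 i)) *m P.
Proof.
move=> /unitarymxP PP; rewrite !mulmxA -(mulmxA _ P) PP mulmx1.
by rewrite -(mulmxA _ (diag_mx x)) mulmx_diag.
Qed.

Lemma tr_diag_conj n (P : 'M[C]_n) (x : 'rV[C]_n) : P \is unitarymx ->
  \tr (P^t* *m diag_mx x *m P) = \sum_i x 0 i.
Proof.
by move=> /unitarymxP PP; rewrite mxtrace_mulC mulmxA PP mul1mx mxtrace_diag.
Qed.

Lemma adj_diag_conj n (P : 'M[C]_n) (x : 'rV[C]_n) : map_mx Num.conj x = x ->
  (P^t* *m diag_mx x *m P)^t* = P^t* *m diag_mx x *m P.
Proof. by move=> xr; rewrite !adjmxM trmxCK adj_diag_mx xr mulmxA. Qed.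

End UnitaryConjugation.

(** * Trace norm, positive matrices and states *)

Section States.
Variable R : realType.
Local Notation C := R[i].

(** [U] is the sign of [X] in an eigenbasis of [X], so that [U *m X] is the absolute value of
    [X]. *)
Lemma trnorm_sign n (X : 'M[C]_n) : X \is hermsymmx ->
  0 <= trnorm X /\
  exists U : 'M[C]_n, [/\ U^t* = U, U *m U = 1%:M & trnorm X = complex.Re (\tr (U *m X))].
Proof.
move=> hX; have [P uP [x xr XE]] := hermsymmx_spectral hX.
have x_real i : x 0 i \is Num.real.
  by apply/CrealP; move/matrixP/(_ 0 i): xr; rewrite mxE.
have XX : X^t* *m X = X *m X by rewrite (hermsymmxP _ hX).
(* [sqrtmx] diagonalises [X *m X] in a basis [Q] of its own, which need not diagonalise [X]. *)
have [Q [y [uQ y0 YE sqE]]] : exists (Q : 'M[C]_n) (y : 'rV[C]_n),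
  [/\ Q \is unitarymx, forall i, 0 <= y 0 i,
    X *m X = Q^t* *m diag_mx y *m Q
  & sqrtmx (X *m X) = Q^t* *m diag_mx (map_mx sqrtC y) *m Q].
  have hY := hermsymmx_adj_mul X; rewrite XX in hY.
  exists (spectralmx (X *m X)), (spectral_diag (X *m X)).
  have uQ := spectral_unitarymx (X *m X).
  have YE := orthomx_spectralP (hermitian_normalmx hY).
  move: uQ YE; rewrite /sqrtmx.
  move: (spectralmx _) (spectral_diag _) => Q y uQ YE.
  have /unitarymxP QQ := uQ; rewrite -(invmx_unitary uQ); split=> // i.
  (* Each eigenvalue of [X *m X] is a squared norm, hence nonnegative. *)
  have -> : y 0 i = ((Q *m X) *m (Q *m X)^t*) i i.
    rewrite adjmxM (hermsymmxP _ hX) !mulmxA -(mulmxA Q) YE invmx_unitary //.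
    by rewrite !mulmxA QQ mul1mx -mulmxA QQ mulmx1 !mxE eqxx.
  exact: mulmx_adj_ge0.
(* Uniqueness of the nonnegative square root transfers the computation to the eigenbasis [P] of
   [X]. *)
have TE : sqrtmx (X *m X) = P^t* *m diag_mx (map_mx Num.norm x) *m P.
  rewrite sqE; apply: unitary_diag_sqrt => // [i|i|].
  - by rewrite mxE sqrtC_ge0.
  - by rewrite mxE normr_ge0.
  rewrite (_ : map_mx _ (map_mx sqrtC y) = y); last first.
    by apply/rowP => i; rewrite !mxE sqrtCK.
  rewrite -YE [in LHS]XE mul_diag_conj //; congr (_ *m diag_mx _ *m _).
  by apply/rowP => i; rewrite !mxE real_normK // expr2.
rewrite /trnorm XX TE; split.
  rewrite tr_diag_conj //.
  have : 0 <= \sum_i map_mx Num.norm x 0 i by apply: sumr_ge0 => i _; rewrite mxE.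
  by rewrite lecE => /andP[].
(* A zero eigenvalue gets sign [1], so that [U] squares to the identity even when [X] is
   singular. *)
pose s : 'rV[C]_n := \row_i (if 0 <= x 0 i then 1 else -1).
exists (P^t* *m diag_mx s *m P); split.
- apply: adj_diag_conj; apply/rowP => i; rewrite !mxE.
  by case: ifP => _; rewrite ?rmorphN rmorph1.
- rewrite mul_diag_conj // (_ : \row_i _ = const_mx 1); last first.
    by apply/rowP => i; rewrite !mxE; case: ifP => _; rewrite ?mulrNN mulr1.
  rewrite diag_const_mx mulmx1; apply: mulmx1C; exact/unitarymxP.
- rewrite [in RHS]XE mul_diag_conj // !tr_diag_conj //; congr (complex.Re _).
  apply: eq_bigr => i _; rewrite !mxE; case: ifP => x0.
    by rewrite mul1r ger0_norm.
  by rewrite mulN1r ler0_norm // ltW // real_ltNge ?x0.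
Qed.

Lemma psdmx_adj_mul m n (A : 'M[C]_(m, n)) : psdmx (A^t* *m A).
Proof.
split=> [|v]; first exact: hermsymmx_adj_mul.
have := mulmx_adj_ge0 (v^t* *m A^t*) 0.
by rewrite !adjmxM !trmxCK !mulmxA.
Qed.

Lemma psdmx_factor n (A : 'M[C]_n) : psdmx A -> exists B : 'M[C]_n, A = B^t* *m B.
Proof.
case=> hA A0; have [P uP [x xr AE]] := hermsymmx_spectral hA.
have /unitarymxP PP := uP.
have x0 i : 0 <= x 0 i.
  (* Testing positivity on the [i]-th eigenvector isolates the [i]-th eigenvalue. *)
  have := A0 (P^t* *m delta_mx i 0); rewrite adjmxM trmxCK AE.
  rewrite !mulmxA -(mulmxA _ P) PP mulmx1 -(mulmxA _ P) PP mulmx1.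
  by rewrite trmx_delta map_delta_mx -rowE -colE !mxE eqxx.
exists (diag_mx (map_mx sqrtC x) *m P).
rewrite adjmxM adj_diag_mx AE !mulmxA -[_ *m _ *m diag_mx _]mulmxA mulmx_diag.
congr (_ *m diag_mx _ *m _); apply/rowP => i; rewrite !mxE.
by rewrite geC0_conj ?sqrtC_ge0 // -expr2 sqrtCK.
Qed.

(** The factorisations tensor: [A'^t* *m A'] and [B'^t* *m B'] give the one of [A' *t B']. *)
Lemma psdmx_tens m n (A : 'M[C]_m) (B : 'M[C]_n) :
  psdmx A -> psdmx B -> psdmx (A *t B).
Proof.
move=> /psdmx_factor[A' ->] /psdmx_factor[B' ->].
by rewrite -tensmx_mul -adjmx_tens; exact: psdmx_adj_mul.
Qed.

Lemma mxtrace_tens m n (A : 'M[C]_m) (B : 'M[C]_n) : \tr (A *t B) = \tr A * \tr B.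
Proof.
rewrite /mxtrace big_mxtens mulr_suml; apply: eq_bigr => i _.
by rewrite mulr_sumr; apply: eq_bigr => j _; rewrite tensmxE.
Qed.

Lemma density_tens m n (A : 'M[C]_m) (B : 'M[C]_n) :
  density m A -> density n B -> density (m * n) (A *t B).
Proof.
move=> [pA tA] [pB tB]; split; first exact: psdmx_tens.
by rewrite mxtrace_tens tA tB mulr1.
Qed.

(** Shows that couplings exist, so that the infimum in [W1] is not taken over the empty set. *)
Lemma coupling_tens n (rho sigma : 'M[C]_n) :
  density n rho -> density n sigma -> coupling rho sigma (rho *t sigma).
Proof.
move=> hr hs; split; first exact: density_tens.
- apply/matrixP => i j; rewrite !mxE.
  under eq_bigr => k _ do rewrite tensmxE.
  by rewrite -mulr_sumr -/(mxtrace sigma) (proj2 hs) mulr1.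
- apply/matrixP => i j; rewrite !mxE.
  under eq_bigr => k _ do rewrite tensmxE.
  by rewrite -mulr_suml -/(mxtrace rho) (proj2 hr) mul1r.
Qed.

Lemma psdmxD n (A B : 'M[C]_n) : psdmx A -> psdmx B -> psdmx (A + B).
Proof.
move=> [/hermsymmxP hA A0] [/hermsymmxP hB B0]; split.
  by apply/hermsymmxP; rewrite adjmxD hA hB.
by move=> v; rewrite mulmxDr mulmxDl mxE addr_ge0.
Qed.

Lemma psdmxZ n (A : 'M[C]_n) (a : C) : 0 <= a -> psdmx A -> psdmx (a *: A).
Proof.
move=> a0 [/hermsymmxP hA A0]; split.
  by apply/hermsymmxP; rewrite adjmxZ geC0_conj // hA.
by move=> v; rewrite -scalemxAr -scalemxAl mxE mulr_ge0.
Qed.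

Lemma separable_density dA dB (sigma : 'M[C]_(dA * dB)) :
  separable dA dB sigma -> density (dA * dB) sigma.
Proof.
move=> [k [p [sA [sB [p0 p1 hA hB ->]]]]].
have h i : density (dA * dB) (sA i *t sB i) by exact: density_tens.
split.
  elim/big_ind: _ => [||i _].
  - rewrite (_ : 0 = (0 : 'M[C]_(dA * dB))^t* *m 0); first exact: psdmx_adj_mul.
    by rewrite mulmx0.
  - by move=> A B; exact: psdmxD.
  - by apply: psdmxZ; [rewrite ler0c | exact: (proj1 (h i))].
rewrite raddf_sum /= -[1]/(1%:C) -p1 rmorph_sum /=; apply: eq_bigr => i _.
by rewrite linearZ /= (proj2 (h i)) mulr1.
Qed.

End States.

(** * Expectation values, Cauchy-Schwarz and the lower bound on the cost *)

Section Expectation.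
Variable R : realType.
Local Notation C := R[i].

Lemma ReD (z w : C) : complex.Re (z + w) = complex.Re z + complex.Re w.
Proof. by case: z; case: w. Qed.

Lemma ReZ (a : R) (z : C) : complex.Re (a%:C * z) = a * complex.Re z.
Proof. by case: z => b c /=; rewrite mul0r subr0. Qed.

(** Duality between the partial trace and [U *t 1]; it turns marginal conditions into expectations
    in the coupling. *)
Lemma mxtrace_ptrace2 m n (U : 'M[C]_m) (T : 'M_(m * n)) :
  \tr (U *m ptrace2 T) = \tr ((U *t 1%:M) *m T).
Proof.
rewrite [RHS]big_mxtens; apply: eq_bigr => a _; rewrite mxE.
under [RHS]eq_bigr => b _ do rewrite mxE big_mxtens.
rewrite exchange_big /=; apply: eq_bigr => c _; rewrite mxE mulr_sumr.
apply: eq_bigr => b _; rewrite (bigD1 b) //= tensmxE mxE eqxx mulr1.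
rewrite big1 ?addr0 // => e ne; rewrite tensmxE mxE eq_sym (negPf ne).
by rewrite mulr0 mul0r.
Qed.

Lemma mxtrace_ptrace1 m n (U : 'M[C]_n) (T : 'M_(m * n)) :
  \tr (U *m ptrace1 T) = \tr ((1%:M *t U) *m T).
Proof.
rewrite [RHS]big_mxtens exchange_big; apply: eq_bigr => b _; rewrite mxE.
under [RHS]eq_bigr => a _ do rewrite mxE big_mxtens exchange_big.
rewrite exchange_big /=; apply: eq_bigr => e _; rewrite mxE mulr_sumr.
apply: eq_bigr => a _; rewrite (bigD1 a) //= tensmxE mxE eqxx mul1r.
rewrite big1 ?addr0 // => c ne; rewrite tensmxE mxE eq_sym (negPf ne).
by rewrite mul0r mul0r.
Qed.

(** Taking the real part gives a real-linear functional on all matrices, Hermitian or not, so that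
    final estimates are linear arithmetic over [R]. *)
Definition expval n (tau X : 'M[C]_n) : R := complex.Re (\tr (X *m tau)).

Section Fixed.
Variables (n : nat) (tau : 'M[C]_n).
Hypothesis htau : density n tau.
Local Notation ev := (expval tau).

Lemma expvalD X Y : ev (X + Y) = ev X + ev Y.
Proof. by rewrite /expval mulmxDl mxtraceD ReD. Qed.

Lemma expvalZ (a : R) X : ev (a%:C *: X) = a * ev X.
Proof. by rewrite /expval -scalemxAl mxtraceZ ReZ. Qed.

Lemma expvalN X : ev (- X) = - ev X.
Proof. by apply/eqP; rewrite -addr_eq0 -expvalD addNr /expval mul0mx mxtrace0. Qed.

Lemma expvalB X Y : ev (X - Y) = ev X - ev Y.
Proof. by rewrite expvalD expvalN. Qed.

Lemma expvalMn X m : ev (X *+ m) = ev X *+ m.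
Proof.
elim: m => [|m IH]; last by rewrite !mulrS expvalD IH.
by rewrite !mulr0n -(subrr X) expvalB subrr.
Qed.

Lemma expval_nat m : ev m%:R%:M = m%:R.
Proof.
rewrite /expval mul_scalar_mx mxtraceZ (proj2 htau) mulr1.
by rewrite -(rmorph_nat (real_complex R)).
Qed.

Lemma expval_sqr_ge0 X : X^t* = X -> 0 <= ev (X *m X).
Proof.
move=> hX; suff : 0 <= \tr (X *m X *m tau) by rewrite lecE => /andP[].
(* By cyclicity the trace is that of [X *m tau *m X], whose diagonal entries are the values of the
   form [tau] on the columns of [X]. *)
rewrite -mulmxA mxtrace_mulC; apply: sumr_ge0 => k _.
have := (proj2 (proj1 htau)) (col k X); congr (_ <= _).
rewrite tr_col map_row hX -row_mul !mxE.
by apply: eq_bigr => j _; rewrite [row _ _ _ _]mxE [col _ _ _ _]mxE.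
Qed.

End Fixed.

(** The polynomial [y * t ^ 2 - x * t + 2] is nonnegative, so its discriminant [x ^ 2 - 8 * y] is
    not positive. *)
Lemma sqr_le_discriminant (x y : R) :
  0 <= y -> (forall t, t * x <= t ^+ 2 * y + 2) -> x ^+ 2 <= 8 * y.
Proof.
rewrite le_eqVlt => /orP[/eqP <- h|y0 h].
  have [->|xN0] := eqVneq x 0; first by rewrite expr0n mulr0.
  (* For [y = 0] this [t] would give [3 <= 2]. *)
  by have := h (3 / x); rewrite divfK // mulr0; lra.
(* The minimiser of the polynomial in [t]. *)
have := h (x / (2 * y)).
have -> : x / (2 * y) * x = x ^+ 2 * (2 * y)^-1 by rewrite expr2 mulrAC.
have -> : (x / (2 * y)) ^+ 2 * y = x ^+ 2 * (2 * y)^-1 / 2.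
  by field; rewrite gt_eqF.
set z := x ^+ 2 * _ => hz.
have -> : x ^+ 2 = z * (2 * y) by rewrite /z mulfVK // gt_eqF // mulr_gt0.
nra.
Qed.

(* [U] is the sign of [rho - sigma]. With [D = U (x) 1 - 1 (x) U] and
   [K = 1 - S], anticommutation of [S] and [D] gives [K D + D K = 2 D], while
   [K ^ 2 = 2 K] and [D ^ 2 <= 4]; the bound is then Cauchy-Schwarz. *)
Lemma trnorm_coupling_le n (S : 'M[C]_(n * n)) (rho sigma : 'M[C]_n) tau :
  S^t* = S -> S *m S = 1%:M ->
  (forall U V : 'M_n, S *m (U *t V) = (V *t U) *m S) ->
  rho \is hermsymmx -> sigma \is hermsymmx -> coupling rho sigma tau ->
  trnorm (rho - sigma) ^+ 2 <= 8 * expval tau (1%:M - S).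
Proof.
move=> hS SS swapS /hermsymmxP hrho /hermsymmxP hsigma [htau tau2 tau1].
have [|_ [U [hU UU ->]]] := @trnorm_sign R n (rho - sigma).
  by apply/hermsymmxP; rewrite adjmxB hrho hsigma.
pose D := U *t 1%:M - 1%:M *t U; pose E := U *t 1%:M + 1%:M *t U.
pose K := 1%:M - S.
have -> : complex.Re (\tr (U *m (rho - sigma))) = expval tau D.
  rewrite mulmxBr -tau2 -tau1 raddfB /= mxtrace_ptrace2 mxtrace_ptrace1.
  by rewrite -raddfB /= -mulmxBl.
have KK : K *m K = K + K.
  rewrite /K mulmxBl !mulmxBr SS !mulmx1 !mul1mx; congr (_ + _).
  by rewrite opprB.
have KD : K *m D + D *m K = D + D.
  rewrite /K (mulmxBl 1%:M S D) (mulmxBr D 1%:M S) mulmx1 mul1mx.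
  have -> : S *m D = - (D *m S).
    by rewrite mulmxBr mulmxBl !swapS opprB.
  by rewrite opprK addrACA subrr addr0.
(* The cross terms in [U *t U] cancel and [U] squares to one. As [E *m E] has nonnegative
   expectation, this is the bound [D ^ 2 <= 4]. *)
have DE : D *m D + E *m E = 4%:R%:M.
  have -> : E *m E = (U *m U) *t 1%:M + 1%:M *t (U *m U) + (U *t U) *+ 2.
    rewrite mulmxDl !mulmxDr !tensmx_mul !mulmx1 !mul1mx mulr2n.
    by rewrite [X in _ + X = _]addrC addrACA.
  rewrite -[D *m D]/(D ^+ 2) tensmx_comm_sqr UU tens_scalar_scalar_mx mulr1.
  by rewrite addrACA addNr addr0 -!raddfD /=; congr (_%:M); ring.
have hD : D^t* = D.
  by rewrite adjmxB !adjmx_tens hU adjmx1.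
have hE : E^t* = E.
  by rewrite adjmxD !adjmx_tens hU adjmx1.
have hK : K^t* = K by rewrite adjmxB adjmx1 hS.
have K0 : 0 <= expval tau K.
  by have := expval_sqr_ge0 htau hK; rewrite KK expvalD; lra.
apply: sqr_le_discriminant => // t.
have KE : 1%:M - S = K by [].
rewrite KE; clearbody D E K.
(* The expectation of the square of [t K - D] is at most [2 t ^ 2 ev K - 2 t ev D + 4], which is
   twice the required quadratic inequality. *)
have hL : (t%:C *: K - D)^t* = t%:C *: K - D.
  by rewrite adjmxB adjmxZ conj_Creal ?complex_real // hK hD.
have := expval_sqr_ge0 htau hL; have := expval_sqr_ge0 htau hE.
have -> : (t%:C *: K - D) *m (t%:C *: K - D)
    = (t ^+ 2)%:C *: (K *m K) - t%:C *: (K *m D + D *m K) + D *m D.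
  rewrite mulmxBl !mulmxBr -!scalemxAl -!scalemxAr scalerA -expr2 -rmorphXn /=.
  by rewrite scalerDr opprB opprD !addrA addrAC.
have := congr1 (expval tau) DE; rewrite expval_nat // expvalD.
rewrite KK KD expvalD expvalB !expvalZ !expvalD.
by lra.
Qed.

Lemma comm_1B (K : pzRingType) (x y : K) :
  GRing.comm x y -> GRing.comm (1 - x) (1 - y).
Proof.
move=> xy; apply: commrB; first exact: commr1.
by apply: commr_sym; apply: commrB; [exact: commr1 | exact/commr_sym].
Qed.

(** Each of [1 - x] and [1 - y] squares to twice itself, and they commute. *)
Lemma involutive_1B_mul_sqr (K : pzRingType) (x y : K) :
  GRing.comm x y -> x * x = 1 -> y * y = 1 ->
  ((1 - x) * (1 - y)) * ((1 - x) * (1 - y)) = ((1 - x) * (1 - y)) *+ 4.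
Proof.
have sqr1B (z : K) : z * z = 1 -> (1 - z) ^+ 2 = (1 - z) *+ 2.
  by move=> zz; rewrite expr2 mulrBl !mulrBr zz !mulr1 !mul1r opprB.
move=> /comm_1B xy xx yy; rewrite -expr2 exprMn_comm // !sqr1B //.
by rewrite mulrnAl mulrnAr -mulrnA.
Qed.

(* [1 - S_A] and [1 - S_B] are commuting positive matrices, so their product is
   positive, and [cost = 2 (dA + dB - 2) + 2 (1 - S_A) (1 - S_B)
   + 2 (1 - S_A S_B)]. *)
Lemma cost_ge_swap dA dB (FA : 'I_(dA ^ 2 - 1) -> 'M[C]_dA)
    (FB : 'I_(dB ^ 2 - 1) -> 'M[C]_dB) tau :
  cost_family FA -> cost_family FB -> (0 < dA)%N -> (0 < dB)%N ->
  density (dA * dB * (dA * dB)) tau ->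
  2 * expval tau (1%:M - fun_mx C (@swapA dA dB) *m fun_mx C (@swapB dA dB))
    <= expval tau (cost FA FB).
Proof.
move=> hFA hFB dA0 dB0 htau; rewrite costE //.
have hA := fun_mx_adj C (@swapAK dA dB); have AA := fun_mx_sqr C (@swapAK dA dB).
have hB := fun_mx_adj C (@swapBK dA dB); have BB := fun_mx_sqr C (@swapBK dA dB).
have := swapAB_mx_comm C dA dB.
move: (fun_mx C (@swapA dA dB)) (fun_mx C (@swapB dA dB)) hA AA hB BB.
move=> A B hA AA hB BB AB.
have comm1B := comm_1B AB.
pose G := (1 - A) * (1 - B).
have hG : G^t* = G by rewrite adjmxM !adjmxB adjmx1 hA hB [RHS]comm1B.
have G0 : 0 <= expval tau G.
  (* A Hermitian matrix whose square is four times itself has nonnegative expectation. *)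
  have GG : G *m G = G *+ 4 := involutive_1B_mul_sqr AB AA BB.
  by have := expval_sqr_ge0 htau hG; rewrite GG expvalMn pmulrn_lge0.
move: G0; rewrite /G mulrBl !mulrBr !mulr1 !mul1r.
rewrite expvalMn !expvalB expvalD !expval_nat // -[A * B]/(A *m B).
rewrite -[1]/(1%:R%:M) -[1%:M]/(1%:R%:M) !expval_nat // natrD => G0.
have hdA : 1 <= dA%:R :> R by rewrite ler1n.
have hdB : 1 <= dB%:R :> R by rewrite ler1n.
by lra.
Qed.

End Expectation.

(** * From couplings to the infimum over separable states *)

Theorem theorem12 (R : realType) (dA dB : nat)
  (FA : 'I_(dA ^ 2 - 1) -> 'M[R[i]]_dA) (FB : 'I_(dB ^ 2 - 1) -> 'M[R[i]]_dB)
  (hFA : cost_family FA) (hFB : cost_family FB)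
  (rho : 'M[R[i]]_(dA * dB)) (hrho : density (dA * dB) rho) :
  inf [set trnorm (rho - sigma) | sigma in separable dA dB] <= 2 * went FA FB rho.
Proof.
(* In dimension zero every trace vanishes, against [\tr rho = 1]. *)
have [dA0 dB0] : (0 < dA)%N /\ (0 < dB)%N.
  apply/andP; rewrite -muln_gt0; case: posnP => // d0.
  have := proj2 hrho; rewrite /mxtrace big1 => [/esym/eqP|[k k_lt]].
    by rewrite oner_eq0.
  by exfalso; rewrite d0 in k_lt.
(* On an empty set of separable states both infima would be the default value [0]. *)
rewrite /went; have [->|/set0P[sigma0 hsigma0]] := eqVneq (@separable R dA dB) set0.
  by rewrite !image_set0 !inf0 mulr0.
(* Converts the bound [8 ev (1 - S)] on the squared trace norm into [2 ev (1 - S)] for the square of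
   its half, which is what the cost dominates. *)
have quarter (x y : R) : x <= 8 * y -> x / 2 ^+ 2 <= 2 * y by lra.
have trnorm_bounds sigma : separable dA dB sigma ->
    0 <= trnorm (rho - sigma) <= 2 * W1 FA FB rho sigma.
  move=> /separable_density hsigma.
  have herm_rho := proj1 (proj1 hrho); have herm_sigma := proj1 (proj1 hsigma).
  have [|trn0 _] := @trnorm_sign R _ (rho - sigma).
    by apply/hermsymmxP; rewrite adjmxB (hermsymmxP _ herm_rho) (hermsymmxP _ herm_sigma).
  (* Half the trace norm is written as the root of its square, so that it suffices to bound that
     square by the cost of every coupling. *)
  rewrite trn0 /= mulrC -ler_pdivrMr // -[leLHS]ger0_norm ?divr_ge0 // -sqrtr_sqr.
  apply: ler_wsqrtr; apply: lb_le_inf.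
    exists (expval (rho *t sigma) (cost FA FB)), (rho *t sigma) => //.
    exact: coupling_tens.
  move=> _ [tau htau <-].
  apply: le_trans (cost_ge_swap hFA hFB dA0 dB0 (let: And3 h _ _ := htau in h)).
  rewrite expr_div_n; apply: quarter.
  apply: trnorm_coupling_le (@swap_tensmx R[i] dA dB) herm_rho herm_sigma htau.
  - by rewrite adjmxM !fun_mx_adj -?swapAB_mx_comm //; [exact: swapAK|exact: swapBK].
  - rewrite {2}swapAB_mx_comm -mulmxA [X in _ *m X]mulmxA.
    by rewrite (fun_mx_sqr _ (@swapBK dA dB)) mul1mx (fun_mx_sqr _ (@swapAK dA dB)).
(* Half the left infimum is a lower bound for every [W1 FA FB rho sigma]. *)
rewrite mulrC -ler_pdivrMr //; apply: lb_le_inf.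
  by exists (W1 FA FB rho sigma0), sigma0.
move=> _ [sigma hsigma <-]; rewrite ler_pdivrMr // mulrC.
have /andP[_] := trnorm_bounds sigma hsigma; apply: le_trans.
apply: ge_inf; last by exists sigma.
(* [ge_inf] needs the set of trace norms to be bounded below. *)
by exists 0 => _ [s hs <-]; case/andP: (trnorm_bounds s hs).
Qed.
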